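(* Let $(b_n)_{n\ge 1}$ be a sequence of positive integers and let $(A_n)_{n\ge1}$ be a sequence of sets with $\{0,1\}\subseteq A_n\subseteq\{0,1,\dots,b_n\}$ for every $n$. Consider the associated $(\{b_n\},\{A_n\},0)$-Sequence. Then every positive integer has a unique legal decomposition with respect to this sequence if and only if for every positive integer $n$ we have $$A_n\in\bigl\{\{0,1\},\ \{0,1,\dots,b_n-1\},\ \{0,1,\dots,b_n\}\bigr\}.$$
   Context: Given positive integers $b_n$ and sets $\{0,1\}\subseteq A_n\subseteq\{0,1,\dots,b_n\}$ ($n\ge 1$), the $(\{b_n\},\{A_n\},0)$-Sequence is a sequence of positive integers arranged consecutively in bins: the first $b_1$ terms form bin 1, the next $b_2$ terms form bin 2, and so on, so bin $n$ has length $b_n$. Given finitely or infinitely many terms arranged in bins in this way, a legal decomposition is a choice of finitely many of the terms such that for every $n$ the number of terms chosen from bin $n$ belongs to $A_n$; it is a decomposition of the integer equal to the sum of the chosen terms. (The ''$0$'' in the name is the adjacency number: there is no restriction relating choices from different bins.) Two legal decompositions are different if they are different choices of terms. The sequence is constructed recursively: the first term (the first element of bin 1) is $1$; once the first $k$ terms have been constructed, the next term (placed in the next available position, filling the bins in order) is the least positive integer that has no legal decomposition using only the first $k$ terms. *)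

(* Defs.v *)
From mathcomp Require Import all_boot finmap.
From mathcomp Require Import boolp.
Set Implicit Arguments. Unset Strict Implicit. Unset Printing Implicit Defensive.
Local Open Scope fset_scope.

(* Bins and positions are numbered from 0: [b n] and [A n] describe bin n+1 of
   the usual 1-based numbering, and [a k] is the (k+1)-st term of the sequence.
   A choice of terms is represented by the finite set of its positions; since 1 \in A n for
   all n, the terms of the sequence are pairwise distinct, so different sets of
   positions are different sets of terms. *)

Definition bin_start (b : nat -> nat) (n : nat) : nat := \sum_(i < n) b i.

Definition in_bin (b : nat -> nat) (n k : nat) : bool :=
  bin_start b n <= k < bin_start b n.+1.

Definition legal (b : nat -> nat) (A : nat -> {fset nat}) (S : {fset nat}) : Prop :=
  forall n, #|` [fset k in S | in_bin b n k]| \in A n.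

Definition legal_decomposition (b : nat -> nat) (A : nat -> {fset nat})
    (a : nat -> nat) (m : nat) (S : {fset nat}) : Prop :=
  legal b A S /\ \sum_(k <- S) a k = m.

Definition decomposable_by_first (b : nat -> nat) (A : nat -> {fset nat})
    (a : nat -> nat) (k m : nat) : Prop :=
  exists2 S : {fset nat},
    legal_decomposition b A a m S & forall i, i \in S -> i < k.

Definition least_positive (P : nat -> Prop) (m : nat) : Prop :=
  [/\ 0 < m, P m & forall m', 0 < m' -> P m' -> m <= m'].

Definition is_bin_sequence (b : nat -> nat) (A : nat -> {fset nat})
    (a : nat -> nat) : Prop :=
  a 0 = 1 /\
  forall k, least_positive
    (fun m => ~ decomposable_by_first b A a k.+1 m) (a k.+1).

(* The recursion determines exactly one sequence. *)

Lemma eq_decomposable_by_first b A a a' k m :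
  (forall i, i < k -> a i = a' i) ->
  decomposable_by_first b A a k m -> decomposable_by_first b A a' k m.
Proof.
move=> eq_a [S [lS sS] Sk]; exists S => //; split=> //.
by rewrite -sS; apply: eq_big_seq => i iS; rewrite eq_a // Sk.
Qed.

Lemma next_term_ex b A a k :
  exists m, least_positive (fun m => ~ decomposable_by_first b A a k m) m.
Proof.
pose P m := (0 < m) && `[< ~ decomposable_by_first b A a k m >].
have exP : exists m, P m.
  exists (\sum_(i <- [fset i in iota 0 k]) a i).+1; apply/asboolP.
  case=> S [_ sS] Sk.
  have SI : S `<=` [fset i in iota 0 k].
    by apply/fsubsetP => i iS; rewrite !inE mem_iota /= add0n Sk.
  have := leqnn (\sum_(i <- S) a i); rewrite {1}sS ltnNge => /negP; apply.
  by rewrite (big_fsetID _ (mem S) [fset i in iota 0 k]) /=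
    (_ : [fset x in [fset i in iota 0 k] | x \in S] = S) ?leq_addr //;
    apply/fsetP => i; rewrite !inE andb_idl // => /(fsubsetP SI); rewrite !inE.
case: (ex_minnP exP) => m /andP[m0 /asboolP mP] mmin.
by exists m; split=> // m' m'0 m'P; apply: mmin; rewrite /P m'0; apply/asboolP.
Qed.

Lemma bin_sequence_exists (b : nat -> nat) (A : nat -> {fset nat}) :
  exists a, is_bin_sequence b A a.
Proof.
have [F FP] := choice (fun s : seq nat => next_term_ex b A (nth 0 s) (size s)).
pose L := fix L k := if k is k'.+1 then rcons (L k') (F (L k')) else [:: 1].
have sL k : size (L k) = k.+1 by elim: k => //= k IH; rewrite size_rcons IH.
pose a k := nth 0 (L k) k.
have aL k i : i < k.+1 -> nth 0 (L k) i = a i.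
  elim: k => [|k IH]; first by case: i.
  rewrite ltnS leq_eqVlt => /orP[/eqP-> //|ik] /=.
  by rewrite nth_rcons sL ik IH.
exists a; split=> // k.
have -> : a k.+1 = F (L k) by rewrite /a /= nth_rcons sL ltnn eqxx.
have [m0 mP mmin] := FP (L k); rewrite sL in mP mmin.
split=> // [D|m' m'0 m'P]; first by apply/mP/(eq_decomposable_by_first _ D) => i /aL.
by apply: mmin => // D; apply/m'P/(eq_decomposable_by_first _ D) => i /aL.
Qed.

Lemma bin_sequence_unique (b : nat -> nat) (A : nat -> {fset nat}) a a' :
  is_bin_sequence b A a -> is_bin_sequence b A a' -> a =1 a'.
Proof.
move=> [a0 aP] [a'0 a'P]; elim/ltn_ind => -[|k] IH; first by rewrite a0 a'0.
have [p1 n1 l1] := aP k; have [p2 n2 l2] := a'P k.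
apply/eqP; rewrite eqn_leq l1 ?l2 // => D.
- by apply/n1/(eq_decomposable_by_first _ D) => i /IH.
- by apply/n2/(eq_decomposable_by_first _ D) => i /IH.
Qed.

(* Main.v *)
(** Each bin reduces to a one-bin problem.  Suppose that the legal sums over the
    bins before bin [n] are exactly [0, ..., N - 1], each obtained once, so that
    [N] is the first term of bin [n].  Division by [N] separates the choice in
    the earlier bins from the choice in bin [n], whose terms are therefore [N]
    times the terms of the sequence with a single bin and cardinalities [A n].
    These are [1, 2, 3, ...] if [A n = {0, 1}] and [1, 2, 4, ...] if [A n] is
    [{0, ..., b n - 1}] or [{0, ..., b n}]; in all three cases the legal sums
    again form an initial segment without repetition.  Existence never fails,
    because the sequence is increasing.

    Conversely, take the first set [A n] of another kind and let [t] be the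
    least number missing from it.  If [2 < t < b n], the one-bin terms are
    [2 ^ i] for [i < t], then [2 ^ t - 1] and [3 * 2 ^ (t - 1) - 2]; the last
    one plus [1] equals [2 ^ t - 1 + 2 ^ (t - 1)].  If [t = 2], let [s >= 3] be
    the next element of [A n]; the one-bin terms start with [1, ..., s + 2].
    When [b n >= s + 2], exchanging [2 + (s + 1)] and [1 + (s + 2)] in an
    [s]-element sum gives two decompositions.  When [b n] is [s] or [s + 1],
    uniqueness makes the sums over the bins up to [n] and the sums over the
    later bins a tiling of the naturals.  By an argument of de Bruijn, the least
    sum [V = N s (s + 1) / 2] of the first kind above the next term
    [X = N (b n + 1)] is then a multiple of [X] and starts a whole interval
    [[V, V + X)] of such sums, which is impossible. *)

Require Import Defs.
From mathcomp Require Import all_boot finmap zify.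
From mathcomp Require Import boolp classical_sets functions.
Set Implicit Arguments. Unset Strict Implicit. Unset Printing Implicit Defensive.
Local Open Scope classical_set_scope.
Local Open Scope fset_scope.
Local Open Scope nat_scope.

(** * Tilings of the naturals *)

Definition tiling (B C : set nat) : Prop :=
  set_bij (B `*` C)%classic setT (fun xy : nat * nat => xy.1 + xy.2).

Section TilingGap.

Variables (B C : set nat) (X V : nat).
Hypothesis tilingBC : tiling B C.
Hypothesis X_gt0 : 0 < X.
Hypothesis B_below : (`I_X `<=` B)%classic.
Hypothesis C_X : C X.
Hypothesis B_V : B V.
Hypothesis X_le_V : X <= V.
Hypothesis B_gap : forall x, B x -> x < V -> x < X.

Lemma tiling_ex m : exists x y, [/\ B x, C y & x + y = m].
Proof. by have [_ _ /(_ m I)[[x y] [Bx Cy] xyE]] := tilingBC; exists x, y. Qed.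

Lemma tiling_inj x y x' y' :
  B x -> C y -> B x' -> C y' -> x + y = x' + y' -> y = y'.
Proof.
move=> Bx Cy Bx' Cy' E; have [_ inj _] := tilingBC.
by have [_ ->] : (x, y) = (x', y') by apply: inj; rewrite ?inE.
Qed.

Lemma tiling_B0 : B 0.
Proof. exact: B_below. Qed.

Lemma tiling_C0 : C 0.
Proof. by have [[|x] [[|y] []]] := tiling_ex 0. Qed.

Lemma tiling_gap_multiple q : q * X < V -> C (q * X).
Proof.
elim: q => [_|q IHq qV]; first exact: tiling_C0.
have [x [y [Bx Cy xyE]]] := tiling_ex (q.+1 * X).
have xX : x < X by apply: B_gap Bx _; lia.
have [yE|/eqP y_neq] := eqVneq y (q.+1 * X); first by rewrite -yE.
rewrite mulSn in xyE y_neq qV.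
have Cq : C (q * X) by apply: IHq; lia.
have Bz : B (y - q * X) by apply: B_below => /=; lia.
by have := tiling_inj tiling_B0 Cy Bz Cq; lia.
Qed.

Lemma tiling_gap_dvd : X %| V.
Proof.
have VE := divn_eq V X; have rX := ltn_pmod V X_gt0.
have [r0|r_gt0] := posnP (V %% X); first by rewrite /dvdn r0.
have Cq : C (V %/ X * X) by apply: tiling_gap_multiple; lia.
by have := tiling_inj (B_below rX) Cq B_V tiling_C0; lia.
Qed.

Lemma tiling_gap_interval r : r < X -> B (V + r).
Proof.
move=> rX; have [x [y [Bx Cy xyE]]] := tiling_ex (V + r).
have [y0|y_gt0] := posnP y; first by rewrite -xyE y0 addn0.
have [yX|Xy] := ltnP y X.
  by have := tiling_inj (B_below yX) tiling_C0 tiling_B0 Cy; lia.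
have xX : x < X by apply: B_gap Bx _; lia.
have [yV|Vy|yV] := ltngtP y V.
- have VE := divnK tiling_gap_dvd.
  have q_gt0 : 0 < V %/ X by rewrite divn_gt0.
  have pE : (V %/ X).-1 * X + X = V by rewrite -mulSnr prednK.
  have Cp : C ((V %/ X).-1 * X) by apply: tiling_gap_multiple; lia.
  have Bz : B (y - (V %/ X).-1 * X) by apply: B_below => /=; lia.
  by have := tiling_inj Bz Cp tiling_B0 Cy; lia.
- (* [(X - z) + (V + z) = V + X] for [z := y - V]. *)
  have Bz : B (X - (y - V)) by apply: B_below => /=; lia.
  by have := tiling_inj Bz Cy B_V C_X; lia.
- by rewrite yV in Cy; have := tiling_inj B_V tiling_C0 tiling_B0 Cy; lia.
Qed.

End TilingGap.

(** * Finite sets of naturals and their weighted sums *)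

Lemma set_bij_mixed_radix (U V W : Type) (P : set U) (Q : set V)
    (f : U -> nat) (g : V -> nat) (u : U -> V -> W) (h : W -> nat) N Y :
  set_bij P `I_N f -> set_bij Q `I_Y g ->
  (forall x y, P x -> Q y -> h (u x y) = f x + N * g y) ->
  set_bij [set u x y | x in P & y in Q] `I_(N * Y) h.
Proof.
move=> [f_lt f_inj f_surj] [g_lt g_inj g_surj] hE; split.
- move=> _ [x Px [y Qy <-]] /=; rewrite hE //.
  by have := f_lt _ Px; have := g_lt _ Qy => /=; nia.
- move=> _ _ /set_mem[x Px [y Qy <-]] /set_mem[x' Px' [y' Qy' <-]].
  rewrite !hE // => E; have := f_lt _ Px; have := f_lt _ Px' => /= x'N xN.
  have gE : g y = g y' by nia.
  have fE : f x = f x' by move: E; rewrite gE => /addIn.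
  by congr u; [apply: f_inj | apply: g_inj]; rewrite ?inE.
- move=> m /= mNY; have N_gt0 : 0 < N by lia.
  have [x Px xE] := f_surj _ (ltn_pmod m N_gt0).
  have [|y Qy yE] := g_surj (m %/ N); first by rewrite /= ltn_divLR // mulnC.
  exists (u x y); first by exists x => //; exists y.
  by rewrite hE // xE yE {3}(divn_eq m N) addnC mulnC.
Qed.

Definition is_mex (E : set nat) (x : nat) : Prop :=
  ~ E x /\ (`I_x `<=` E)%classic.

Lemma is_mex_inj E x y : is_mex E x -> is_mex E y -> x = y.
Proof.
by move=> [nEx ltE] [nEy ltE']; case: (ltngtP x y) => // [/ltE'|/ltE].
Qed.

Lemma is_mex_ex (E : set nat) x : ~ E x -> exists y, is_mex E y.
Proof.
move=> nEx; have exE : exists y, ~~ `[< E y >] by exists x; exact/asboolPn.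
case: (ex_minnP exE) => y /asboolPn nEy y_min; exists y; split=> // z /= zy.
by apply/asboolP; apply: contraTT zy => /y_min; rewrite leqNgt.
Qed.

Lemma set_bij_mex (T : Type) (P : set T) (f : T -> nat) N :
  set_bij P `I_N f -> is_mex (f @` P)%classic N.
Proof. by move=> [lt _ surj]; split=> // -[x /lt /= + fx]; rewrite fx ltnn. Qed.

Definition segment (j : nat) : {fset nat} := [fset i in iota 0 j].

Lemma in_segment j i : (i \in segment j) = (i < j).
Proof. by rewrite !inE mem_iota. Qed.

Lemma segment0 : segment 0 = fset0.
Proof. by apply/fsetP => i; rewrite in_segment in_fset0. Qed.

Lemma segmentS j : segment j.+1 = j |` segment j.
Proof. by apply/fsetP => i; rewrite in_fset1U !in_segment; lia. Qed.

Lemma card_segment j : #|` segment j| = j.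
Proof.
elim: j => [|j IHj]; first by rewrite segment0 cardfs0.
by rewrite segmentS cardfsU1 in_segment ltnn IHj.
Qed.

Lemma segment_mex j : is_mex [set` segment j] j.
Proof. by split=> [|k] /=; rewrite in_segment ?ltnn. Qed.

Lemma fsub_segmentP (T : {fset nat}) j :
  reflect (forall i, i \in T -> i < j) (T `<=` segment j).
Proof.
by apply: (iffP (@fsubsetP _ _ _)) => sT i /sT; rewrite in_segment.
Qed.

Lemma fdisjoint_segmentP (T : {fset nat}) j :
  reflect (forall i, i \in T -> j <= i) [disjoint T & segment j]%fset.
Proof.
by apply: (iffP (@fdisjointP _ _ _)) => dT i iT; move: (dT i iT);
  rewrite in_segment -leqNgt.
Qed.

Lemma fsub_segmentW (T : {fset nat}) i j :
  i <= j -> T `<=` segment i -> T `<=` segment j.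
Proof.
by move=> ij /fsub_segmentP sT; apply/fsub_segmentP => k /sT; lia.
Qed.

Lemma fsub_segmentD1 (T : {fset nat}) j :
  T `<=` segment j.+1 -> T `\ j `<=` segment j.
Proof.
by move=> /fsub_segmentP sT; apply/fsub_segmentP => i /fsetD1P[ij /sT]; lia.
Qed.

Lemma fsub_segment_card (T : {fset nat}) j : T `<=` segment j -> #|` T| <= j.
Proof. by move=> /fsubset_leq_card; rewrite card_segment. Qed.

Lemma fsub_segment_eq (T : {fset nat}) j :
  T `<=` segment j -> j <= #|` T| -> T = segment j.
Proof. by move=> sT jT; apply/eqP; rewrite eqEfcard sT card_segment. Qed.

Lemma fsub_segment_ex (T : {fset nat}) : exists j, T `<=` segment j.
Proof.
exists (\max_(i <- T) i).+1; apply/fsub_segmentP => i iT.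
by rewrite ltnS (big_fsetD1 i) //= leq_maxl.
Qed.

Definition shift (p : nat) (T : {fset nat}) : {fset nat} :=
  [fset p + i | i in T].

Lemma in_shift p (T : {fset nat}) k :
  (k \in shift p T) = (p <= k) && (k - p \in T).
Proof.
apply/imfsetP/andP => [[i /= iT ->]|[pk kT]]; first by rewrite leq_addr addKn.
by exists (k - p); rewrite ?subnKC.
Qed.

Lemma shift_ex p j (S : {fset nat}) :
  [disjoint S & segment p]%fset -> S `<=` segment (p + j) ->
  exists2 T, T `<=` segment j & S = shift p T.
Proof.
move=> /fdisjoint_segmentP dS /fsub_segmentP sS.
exists [fset i in segment j | p + i \in S].
  by apply/fsubsetP => i; rewrite !inE => /andP[].
apply/fsetP => k; rewrite in_shift !inE mem_iota /=.
case: (boolP (k \in S)) => [kS|kS].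
  have pk := dS k kS; have kpj := sS k kS.
  by rewrite subnKC // kS pk; lia.
by case: (leqP p k) => // pk; rewrite subnKC // (negbTE kS) andbF.
Qed.

Lemma card_shift p T : #|` shift p T| = #|` T|.
Proof. by rewrite card_imfset //; exact: addnI. Qed.

Lemma shift_inj p : injective (shift p).
Proof.
move=> T T' E; apply/fsetP => i.
by have /fsetP/(_ (p + i)) := E; rewrite !in_shift leq_addr addKn.
Qed.

Section WeightedSum.

Variables (K : choiceType) (w : K -> nat).
Implicit Types S T : {fset K}.

Definition wsum S : nat := \sum_(i <- S) w i.

Lemma wsum0 : wsum fset0 = 0.
Proof. exact: big_seq_fset0. Qed.

Lemma wsum1 i : wsum [fset i] = w i.
Proof. exact: big_seq_fset1. Qed.

Lemma wsumU1 i T : i \notin T -> wsum (i |` T) = w i + wsum T.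
Proof. exact: big_fsetU1. Qed.

Lemma wsumD1 i T : wsum T = (i \in T) * w i + wsum (T `\ i).
Proof.
have [iT|iT] := boolP (i \in T); last by rewrite mem_fsetD1.
by rewrite /wsum (big_fsetD1 i) //= mul1n.
Qed.

Lemma wsumU S T : [disjoint S & T]%fset -> wsum (S `|` T) = wsum S + wsum T.
Proof.
move=> dST; rewrite /wsum (big_fsetID _ (mem S)) /=; congr (_ + _).
  by apply: eq_fbigl => i; rewrite !inE; case: (i \in S); rewrite ?andbF.
apply: eq_fbigl => i; rewrite !inE; case: (boolP (i \in S)) => [iS|_].
  by rewrite andbF (negbTE (fdisjointP dST _ iS)).
by rewrite andbT.
Qed.

End WeightedSum.

Lemma wsum_shift p N w v (T : {fset nat}) :
  (forall i, i \in T -> v (p + i) = N * w i) ->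
  wsum v (shift p T) = N * wsum w T.
Proof.
move=> vE; rewrite /wsum big_imfset /=; last by move=> i j _ _ /addnI.
by rewrite big_distrr; apply: eq_big_seq.
Qed.

Lemma wsum_segmentS w j : wsum w (segment j.+1) = w j + wsum w (segment j).
Proof. by rewrite segmentS wsumU1 // in_segment ltnn. Qed.

Lemma wsum_segment_pow2 j : wsum (expn 2) (segment j) = (2 ^ j).-1.
Proof.
elim: j => [|j IHj]; first by rewrite segment0 wsum0.
by rewrite wsum_segmentS IHj expnS; have := expn_gt0 2 j; lia.
Qed.

Lemma wsum_segment_succn j : 2 * wsum succn (segment j) = j * j.+1.
Proof.
elim: j => [|j IHj]; first by rewrite segment0 wsum0.
by rewrite wsum_segmentS mulnDr IHj; lia.
Qed.

Lemma wsum_succn_ge (T : {fset nat}) : #|` T| * #|` T|.+1 <= 2 * wsum succn T.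
Proof.
have [j] := fsub_segment_ex T; elim: j T => [|j IHj] T sT.
  by move: sT; rewrite segment0 fsubset0 => /eqP ->; rewrite cardfs0.
have sT' := fsub_segmentD1 sT; have := IHj _ sT'; have := fsub_segment_card sT'.
rewrite (wsumD1 _ j T) (cardfsD1 j T).
by case: (_ \in _) => /=; nia.
Qed.

Lemma powerset_segment_pow2_bij j :
  set_bij [set T | T `<=` segment j] `I_(2 ^ j) (wsum (expn 2)).
Proof.
elim: j => [|j IHj].
  rewrite segment0 (_ : [set T | _] = [set fset0]%classic).
    split=> [_ ->|_ _ /set_mem -> /set_mem ->|m /=] //.
      by rewrite /= wsum0.
    by rewrite ltnS leqn0 => /eqP ->; exists fset0; rewrite ?wsum0.
  by apply/seteqP; split=> T /=; rewrite fsubset0 => /eqP.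
rewrite expnSr (_ : [set T | _] =
    [set if c then j |` T else T |
      T in [set T | T `<=` segment j] & c in setT]).
  apply: (set_bij_mixed_radix (g := nat_of_bool)) IHj _ _.
    split=> [[]//|[] [] //|[|[|//]] _]; [by exists false|by exists true].
  move=> T [] /fsub_segmentP sT _ /=; last by rewrite muln0 addn0.
  by rewrite wsumU1 ?muln1 1?addnC //; apply/negP => /sT; rewrite ltnn.
apply/seteqP; split=> [T /= sT|_ [T sT [c _ <-]] /=].
  exists (T `\ j); first exact: fsub_segmentD1.
  exists (j \in T) => //; case: ifPn => jT; first by rewrite fsetD1K.
  by rewrite mem_fsetD1.
case: c; last exact: fsub_segmentW sT.
by rewrite segmentS fsetUS.
Qed.

(** * One bin *)

Definition choices (D : {fset nat}) (j : nat) : set {fset nat} :=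
  [set T | T `<=` segment j /\ #|` T| \in D].

Definition choice_sums (D : {fset nat}) (w : nat -> nat) (j : nat) : set nat :=
  (wsum w @` choices D j)%classic.

(* When [D] is the set of admissible cardinalities of the first bin, the terms
   of that bin are the [w i] for which [greedy] holds. *)
Definition greedy (D : {fset nat}) (w : nat -> nat) (j : nat) : Prop :=
  forall i, i < j -> is_mex (choice_sums D w i) (w i).

Lemma choices_pow2_bij D j : (forall k, k <= j -> k \in D) ->
  set_bij (choices D j) `I_(2 ^ j) (wsum (expn 2)).
Proof.
move=> jD; rewrite (_ : choices D j = [set T | T `<=` segment j]).
  exact: powerset_segment_pow2_bij.
apply/seteqP; split=> T /= => [[]//|sT].
by split=> //; apply/jD/fsub_segment_card.
Qed.

Lemma choices_pow2_pred_bij D j : is_mex [set` D] j ->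
  set_bij (choices D j) `I_(2 ^ j).-1 (wsum (expn 2)).
Proof.
move=> [/negP jD ltjD]; have [lt inj surj] := powerset_segment_pow2_bij j.
have sum_full := wsum_segment_pow2 j; split=> [T [sT cT] /=|T T'|m /= mj].
- suff : wsum (expn 2) T != (2 ^ j).-1 by have := lt T sT => /=; lia.
  apply: contraNneq jD; rewrite -sum_full => /inj TE.
  by rewrite -[j]card_segment -TE ?inE /=.
- by move=> /set_mem[sT _] /set_mem[sT' _]; apply: inj; rewrite inE.
- have [|T /= sT TE] := surj m; first by move=> /=; lia.
  exists T => //; split=> //; apply: ltjD; rewrite /= ltnNge; apply/negP.
  by move=> /(fsub_segment_eq sT) T_full; rewrite T_full sum_full in TE; lia.
Qed.

Lemma greedy_pow2 D t : (forall k, k < t -> k \in D) -> greedy D (expn 2) t.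
Proof.
by move=> tD i it; apply/set_bij_mex/choices_pow2_bij => k ki; apply: tD; lia.
Qed.

Lemma wsum_succn_card_le1 j (T : {fset nat}) :
  T `<=` segment j -> #|` T| <= 1 -> wsum succn T <= j.
Proof.
move=> /fsub_segmentP sT; rewrite leq_eqVlt ltnS leqn0 cardfs_eq0.
case/orP => [/cardfs1P[i TE]|/eqP ->]; last by rewrite wsum0.
by rewrite TE wsum1; apply: sT; rewrite TE fset11.
Qed.

Lemma choice_sums_succn D j : 0 \in D -> 1 \in D ->
  (`I_(j.+1) `<=` choice_sums D succn j)%classic.
Proof.
move=> zero_in_D one_in_D [_|i /= ij].
  by exists fset0; rewrite ?wsum0 //; split; rewrite ?fsub0set ?cardfs0.
exists [fset i]; rewrite ?wsum1 //.
by split; rewrite ?cardfs1 // fsub1set in_segment.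
Qed.

Lemma choices_succn_bij j :
  set_bij (choices [fset 0; 1] j) `I_(j.+1) (wsum succn).
Proof.
have D_le1 k : k \in [fset 0; 1] -> k <= 1 by rewrite !inE => /orP[] /eqP ->.
split; last by apply: choice_sums_succn; rewrite !inE.
  by move=> T [sT /D_le1 cT] /=; rewrite ltnS; exact: wsum_succn_card_le1.
have atom T : choices [fset 0; 1] j T -> T = fset0 \/ exists i, T = [fset i].
  case=> _ /D_le1; rewrite leq_eqVlt ltnS leqn0 cardfs_eq0.
  by case/orP => [/cardfs1P|/eqP ->]; [right|left].
move=> T T' /set_mem/atom aT /set_mem/atom aT'.
by case: aT aT' => [->|[i ->]] [->|[i' ->]]; rewrite ?wsum0 ?wsum1 // => -[->].
Qed.

Definition admissible (bn : nat) (D : {fset nat}) : Prop :=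
  [\/ D = [fset 0; 1], D = segment bn | D = segment bn.+1].

Definition least_above1 (D : {fset nat}) (s : nat) : Prop :=
  s \in D /\ forall k, k \in D -> k <= 1 \/ s <= k.

Lemma least_above1_wsum D s j T : least_above1 D s -> choices D j T ->
  wsum succn T <= j \/ (s <= #|` T| /\ s * s.+1 <= 2 * wsum succn T).
Proof.
move=> [_ D_gap] [sT /D_gap[cT|cT]]; first by left; exact: wsum_succn_card_le1.
by right; split=> //; have := wsum_succn_ge T; nia.
Qed.

Lemma least_above1_sums_gap D s j y : least_above1 D s ->
  choice_sums D succn j y -> y < wsum succn (segment s) -> y <= j.
Proof.
move=> Ds [T cT <-]; have := wsum_segment_succn s.
by case: (least_above1_wsum Ds cT) => // -[]; lia.
Qed.

Lemma least_above1_segment D s j : least_above1 D s -> s <= j ->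
  choice_sums D succn j (wsum succn (segment s)).
Proof.
move=> [sD _] sj; exists (segment s) => //; split; last by rewrite card_segment.
exact: fsub_segmentW (fsubset_refl _).
Qed.

Lemma greedy_succn D s j : 0 \in D -> 1 \in D -> 2 < s -> least_above1 D s ->
  j <= s.+2 -> greedy D succn j.
Proof.
move=> zero_in_D one_in_D s3 Ds js i ij; split; last exact: choice_sums_succn.
by move=> [T cT TE]; case: (least_above1_wsum Ds cT); rewrite TE; nia.
Qed.

Lemma admissible_greedy bn D : admissible bn D ->
  exists w Y, greedy D w bn /\ set_bij (choices D bn) `I_Y (wsum w).
Proof.
case=> DE.
- rewrite DE; exists succn, bn.+1; split; last exact: choices_succn_bij.
  by move=> j _; apply/set_bij_mex/choices_succn_bij.
- exists (expn 2), (2 ^ bn).-1; split.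
    by apply: greedy_pow2 => k; rewrite DE in_segment.
  by rewrite DE; apply/choices_pow2_pred_bij/segment_mex.
- exists (expn 2), (2 ^ bn); split.
    by apply: greedy_pow2 => k kb; rewrite DE in_segment; lia.
  by apply: choices_pow2_bij => k; rewrite DE in_segment.
Qed.

Lemma eq_fset01_or_least_above1 D : 0 \in D -> 1 \in D ->
  D = [fset 0; 1] \/ exists2 s, 1 < s & least_above1 D s.
Proof.
move=> zero_in_D one_in_D.
have [s_ex|no_s] := pselect (exists s, (1 < s) && (s \in D)).
  right; case: (ex_minnP s_ex) => s /andP[s1 sD] s_min; exists s => //.
  split=> // k kD; have [k1|k1] := leqP k 1; [by left|right].
  by apply: s_min; rewrite k1.
left; apply/fsetP => -[|[|k]]; rewrite !inE //=.
by apply/negP => kD; apply: no_s; exists k.+2.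
Qed.

Lemma admissible_or_obstructed bn D :
  0 \in D -> 1 \in D -> D `<=` segment bn.+1 ->
  [\/ admissible bn D, exists2 t, 2 < t < bn & is_mex [set` D] t
    | exists2 s, 2 < s & least_above1 D s].
Proof.
move=> zero_in_D one_in_D /fsub_segmentP D_le.
have D_bn1 : bn.+1 \notin D by apply/negP => /D_le; rewrite ltnn.
have [t mex_t] := @is_mex_ex [set` D] _ (negP D_bn1).
have [/negP tD ltD] := mex_t.
have t_gt1 : 1 < t.
  by case: t tD {mex_t ltD} => [|[|]] //; rewrite ?zero_in_D ?one_in_D.
have t_le : t <= bn.+1 by rewrite leqNgt; apply: contraNN D_bn1 => /ltD.
have [t_bn|bn_t] := ltnP t bn; last first.
  have DE : D = segment t.
    apply/fsetP => k; rewrite in_segment; case: (ltngtP k t) => [/ltD //|tk|->].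
      by apply/negP => /D_le; lia.
    exact/negbTE.
  apply: Or31; move: t_le; rewrite leq_eqVlt ltnS => /orP[/eqP tE|t_bn].
    by apply: Or33; rewrite DE tE.
  by apply: Or32; rewrite DE; congr segment; lia.
have [t_gt2|t_le2] := ltnP 2 t; first by apply: Or32; exists t; rewrite ?t_gt2.
have [DE|[s s1 Ds]] := eq_fset01_or_least_above1 zero_in_D one_in_D.
  exact/Or31/Or31.
apply: Or33; exists s => //; rewrite ltn_neqAle s1 andbT.
by apply: contraNneq tD => s2; rewrite (_ : t = s) ?Ds.1 //; lia.
Qed.

Definition run_weight (u i : nat) : nat :=
  if i <= u then 2 ^ i else if i == u.+1 then (2 ^ u.+1).-1 else 3 * 2 ^ u - 2.

Lemma wsum_run_weight u (T : {fset nat}) : T `<=` segment u.+1 ->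
  wsum (run_weight u) T = wsum (expn 2) T.
Proof.
move=> /fsub_segmentP sT; apply: eq_big_seq => i /sT.
by rewrite /run_weight ltnS => ->.
Qed.

Section RunWeightMex.

Variables (D : {fset nat}) (u : nat).
Hypothesis mexD : is_mex [set` D] u.+1.

Local Notation P := (2 ^ u).

Let P_gt0 : 0 < P.
Proof. by rewrite expn_gt0. Qed.

Let run_weight_last : run_weight u u.+1 = (2 * P).-1.
Proof. by rewrite /run_weight ltnn eqxx expnS. Qed.

Lemma run_weight_sums_notin :
  ~ choice_sums D (run_weight u) u.+2 (3 * P - 2).
Proof.
have [lt_run _ _] := choices_pow2_pred_bij mexD; have [/negP uD _] := mexD.
move=> [T [/fsub_segmentD1 sT cT]]; move: cT.
rewrite (cardfsD1 u.+1) (wsumD1 _ u.+1) wsum_run_weight // run_weight_last.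
case: (u.+1 \in T) => /= cT TE; last first.
  by have := lt_run _ (conj sT cT) => /=; rewrite expnS; have := P_gt0; lia.
(* The remaining sum [P - 1] forces all of [segment u]: too many elements. *)
have [_ inj _] := powerset_segment_pow2_bij u.+1.
suff TE' : T `\ u.+1 = segment u.
  by rewrite TE' card_segment add1n (negbTE uD) in cT.
apply: inj; rewrite ?inE //=; first exact: fsub_segmentW (fsubset_refl _).
by rewrite wsum_segment_pow2; have := P_gt0; lia.
Qed.

Lemma run_weight_sums_below :
  (`I_(3 * P - 2) `<=` choice_sums D (run_weight u) u.+2)%classic.
Proof.
have [_ _ surj_run] := choices_pow2_pred_bij mexD; move=> m /= mP.
have [m_small|m_big] := ltnP m (2 * P).-1.
  have [|T [sT cT] TE] := surj_run m; first by rewrite /= expnS.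
  exists T; last by rewrite wsum_run_weight.
  by split=> //; exact: fsub_segmentW sT.
have [_ _ surj_u] := choices_pow2_pred_bij (segment_mex u).
have [|T [sT cT] TE] := surj_u (m - (2 * P).-1); first by move=> /=; lia.
rewrite in_segment in cT.
have sT' : T `<=` segment u.+1 by exact: fsub_segmentW sT.
have uT : u.+1 \notin T by apply/negP => /(fsub_segmentP _ _ sT); lia.
exists (u.+1 |` T).
  by split; [rewrite segmentS fsetUS|apply: mexD.2; rewrite /= cardfsU1 uT].
by rewrite wsumU1 // wsum_run_weight // run_weight_last TE; lia.
Qed.

End RunWeightMex.

Lemma greedy_run_weight D u : is_mex [set` D] u.+1 ->
  greedy D (run_weight u) u.+3.
Proof.
move=> mexD i; rewrite ltnS leq_eqVlt => /orP[/eqP ->|iu].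
  have -> : run_weight u u.+2 = 3 * 2 ^ u - 2.
    by rewrite /run_weight !ifF //; lia.
  by split; [exact: run_weight_sums_notin|exact: run_weight_sums_below].
have -> : choice_sums D (run_weight u) i = choice_sums D (expn 2) i.
  apply/seteqP; split=> m [T cT <-]; exists T => //; [symmetry|];
    by apply: wsum_run_weight; apply: fsub_segmentW cT.1; lia.
move: iu; rewrite ltnS leq_eqVlt => /orP[/eqP ->|iu].
  by rewrite /run_weight ltnn eqxx; apply/set_bij_mex/choices_pow2_pred_bij.
rewrite /run_weight -ltnS iu; apply: greedy_pow2 iu => k; exact: mexD.2.
Qed.

Lemma least_above1_exchange D s j : least_above1 D s -> 1 < s -> s.+1 < j ->
  ~ set_inj (choices D j) (wsum succn).
Proof.
move=> [sD _] s1 sj inj; pose R i := segment s `\ i.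
have notin i k : s <= k -> k \notin R i by rewrite !inE mem_iota; lia.
have choiceR i k : i < s -> s <= k < j -> choices D j (k |` R i).
  move=> i_s /andP[sk kj]; split.
    by apply/fsub_segmentP => l; rewrite !inE mem_iota; lia.
  rewrite cardfsU1 notin //.
  by have := cardfsD1 i (segment s); rewrite card_segment in_segment i_s => <-.
have : s.+1 |` R 1 = s |` R 0.
  apply: inj; rewrite ?inE; [by apply: choiceR; lia..|].
  have := wsumD1 succn 1 (segment s); have := wsumD1 succn 0 (segment s).
  by rewrite !in_segment !wsumU1 ?notin -/(R 0) -/(R 1); lia.
by move/fsetP/(_ s); rewrite !inE mem_iota; lia.
Qed.

Lemma least_above1_no_interval D s j :
  least_above1 D s -> 2 < s -> s <= j <= s.+1 ->
  j.+1 %| wsum succn (segment s) ->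
  ~ choice_sums D succn j (wsum succn (segment s)).+1.
Proof.
move=> Ds s3 sj dvdV [T cT TE]; have VE := wsum_segment_succn s.
have [jE|jE] : j = s.+1 \/ j = s by lia.
  have : s.+2 %| 2.
    rewrite -(@dvdn_addr (s.+2 * s.-1)) ?dvdn_mulr //.
    have -> : s.+2 * s.-1 + 2 = 2 * wsum succn (segment s) by nia.
    by rewrite dvdn_mull // -jE.
  by move=> /dvdn_leq; lia.
case: (least_above1_wsum Ds cT) => [|[cs _]]; first by rewrite TE; nia.
move: TE; rewrite (@fsub_segment_eq T s) //; first lia.
by case: cT; rewrite jE.
Qed.

(** * The bin sequence *)

Section BinSequence.

Variables (b : nat -> nat) (A : nat -> {fset nat}) (a : nat -> nat).
Hypothesis b_gt0 : forall n, 0 < b n.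
Hypothesis zero_in_A : forall n, 0 \in A n.
Hypothesis one_in_A : forall n, 1 \in A n.

Local Notation start := (bin_start b).

Lemma bin_startS n : start n.+1 = start n + b n.
Proof. by rewrite /bin_start big_ord_recr. Qed.

Lemma leq_bin_start : {homo start : m n / m <= n}.
Proof.
apply: homo_leq => // [m n p|n]; first exact: leq_trans.
by rewrite bin_startS leq_addr.
Qed.

Lemma bin_start_ge n : n <= start n.
Proof. by elim: n => // n IHn; rewrite bin_startS; have := b_gt0 n; lia. Qed.

Lemma in_bin_inj m n k : in_bin b m k -> in_bin b n k -> m = n.
Proof.
by rewrite /in_bin => km kn; case: (ltngtP m n) => // /leq_bin_start; lia.
Qed.

Definition bin_part n (S : {fset nat}) : {fset nat} :=
  [fset k in S | in_bin b n k].

Lemma bin_partU n (S T : {fset nat}) :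
  bin_part n (S `|` T) = bin_part n S `|` bin_part n T.
Proof. by apply/fsetP => i; rewrite !inE andb_orl. Qed.

Lemma fsub_bin_part n (S : {fset nat}) : bin_part n S `<=` S.
Proof. by apply/fsubsetP => i; rewrite !inE => /andP[]. Qed.

Lemma bin_part_eq0 n (S : {fset nat}) :
  (forall i, i \in S -> ~~ in_bin b n i) -> bin_part n S = fset0.
Proof.
move=> Sn; apply/fsetP => i; rewrite !inE /=.
by apply/negP => /andP[/Sn/negP].
Qed.

Lemma legal0 : legal b A fset0.
Proof. by move=> n; rewrite -/(bin_part _ _) bin_part_eq0 ?cardfs0. Qed.

Lemma legal_fset1 k : legal b A [fset k].
Proof.
move=> n; have := fsubset_leq_card (fsub_bin_part n [fset k]).
by rewrite cardfs1 -/(bin_part _ _); case: #|` _| => [|[|]].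
Qed.

Lemma legal_fset2 k l :
  (forall n, in_bin b n k -> in_bin b n l -> 2 \in A n) ->
  legal b A [fset k; l].
Proof.
move=> kl n; rewrite -/(bin_part _ _); have sub := fsub_bin_part n [fset k; l].
have [|c_gt1] := leqP #|` bin_part n [fset k; l]| 1.
  by case: #|` _| => [|[|]].
have c_le2 : #|` [fset k; l]| <= 2 by rewrite cardfs2; case: (_ == _).
have -> : #|` bin_part n [fset k; l]| = 2.
  by have := fsubset_leq_card sub; lia.
have full : bin_part n [fset k; l] = [fset k; l].
  by apply/eqP; rewrite eqEfcard sub (leq_trans c_le2).
have in_n i : i \in [fset k; l] -> in_bin b n i.
  by rewrite -full !inE => /andP[].
by apply: kl; apply: in_n; rewrite !inE eqxx ?orbT.
Qed.

Lemma legal_shift n (T : {fset nat}) : T `<=` segment (b n) ->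
  legal b A (shift (start n) T) <-> #|` T| \in A n.
Proof.
move=> /fsub_segmentP sT.
have T_bin i : i \in shift (start n) T -> in_bin b n i.
  by rewrite in_shift /in_bin bin_startS => /andP[ni /sT]; lia.
have part_n : bin_part n (shift (start n) T) = shift (start n) T.
  by apply/fsetP => i; rewrite !inE /= andb_idr // => /T_bin.
split=> [/(_ n)|cT m]; rewrite -/(bin_part _ _).
  by rewrite part_n card_shift.
have [->|mn] := eqVneq m n; first by rewrite part_n card_shift.
rewrite bin_part_eq0 ?cardfs0 // => i /T_bin iB; apply: contraNN mn => iB'.
exact/eqP/(in_bin_inj iB').
Qed.

Lemma legal_fsetU n (S T : {fset nat}) :
  S `<=` segment (start n) -> [disjoint T & segment (start n)]%fset ->
  legal b A (S `|` T) <-> legal b A S /\ legal b A T.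
Proof.
move=> /fsub_segmentP sS /fdisjoint_segmentP dT.
have S_part m : n <= m -> bin_part m S = fset0.
  move=> /leq_bin_start nm; apply: bin_part_eq0 => i /sS.
  by rewrite /in_bin; lia.
have T_part m : m < n -> bin_part m T = fset0.
  move=> /leq_bin_start nm; apply: bin_part_eq0 => i /dT.
  by rewrite /in_bin; lia.
have partU m : #|` bin_part m (S `|` T)| =
    if m < n then #|` bin_part m S| else #|` bin_part m T|.
  rewrite bin_partU; case: ltnP => [/T_part ->|/S_part ->].
    by rewrite fsetU0.
  by rewrite fset0U.
split=> [lST|[lS lT] m]; last first.
  by rewrite -/(bin_part _ _) partU; case: ifP => _; [exact: lS|exact: lT].
split=> m; have := lST m; rewrite -!/(bin_part _ _) partU.
  by case: ltnP => // /S_part ->; rewrite cardfs0.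
by case: ltnP => // /T_part ->; rewrite cardfs0.
Qed.

Definition legal_upto (k : nat) : set {fset nat} :=
  [set S | legal b A S /\ S `<=` segment k].

Definition legal_from (k : nat) : set {fset nat} :=
  [set S | legal b A S /\ [disjoint S & segment k]%fset].

Lemma legal_cut n :
  legal b A =
    [set S `|` T | S in legal_upto (start n) & T in legal_from (start n)].
Proof.
apply/seteqP; split=> [S lS|_ [S [lS sS] [T [lT dT] <-]]]; last first.
  exact/(legal_fsetU sS dT).
have sS : S `&` segment (start n) `<=` segment (start n) by exact: fsubsetIr.
have dS : [disjoint S `\` segment (start n) & segment (start n)]%fset.
  by apply/fdisjointP => i; rewrite !inE => /andP[].
have [lI lD] : legal b A (S `&` segment (start n)) /\
    legal b A (S `\` segment (start n)).
  by apply/(legal_fsetU sS dS); rewrite fsetID.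
exists (S `&` segment (start n)) => //; exists (S `\` segment (start n)) => //.
exact: fsetID.
Qed.

Lemma legal_upto_bin n j : j <= b n ->
  legal_upto (start n + j) =
    [set S `|` shift (start n) T |
      S in legal_upto (start n) & T in choices (A n) j].
Proof.
move=> jb; apply/seteqP; split=> [ST [lST sST]|_ [S [lS sS] [T [sT cT] <-]]].
  move: lST; rewrite (legal_cut n) => -[S uS [U [lU dU] SUE]].
  move: sST; rewrite -SUE fsubUset => /andP[_ /(shift_ex dU)[T sT UE]].
  exists S => //; exists T; last by rewrite -UE.
  by split=> //; apply/(legal_shift (fsub_segmentW jb sT)); rewrite -UE.
have sTb := fsub_segmentW jb sT; split.
  apply/(legal_fsetU sS); last by split=> //; apply/legal_shift.
  by apply/fdisjoint_segmentP => i; rewrite in_shift => /andP[].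
rewrite fsubUset (fsub_segmentW _ sS) ?leq_addr //=.
apply/fsub_segmentP => i; rewrite in_shift.
by move=> /andP[ni /(fsub_segmentP _ _ sT)]; lia.
Qed.

Definition legal_sums (k : nat) : set nat := (wsum a @` legal_upto k)%classic.

Lemma legal_uptoW i j : i <= j -> (legal_upto i `<=` legal_upto j)%classic.
Proof. by move=> ij S [lS sS]; split=> //; exact: fsub_segmentW sS. Qed.

Lemma decomposableP k m : decomposable_by_first b A a k m <-> legal_sums k m.
Proof.
split=> [[S [lS SE] sS]|[S [lS /fsub_segmentP sS] SE]]; exists S => //.
by split=> //; exact/fsub_segmentP.
Qed.

Hypothesis a_seq : is_bin_sequence b A a.

Lemma legal_sums0 k : legal_sums k 0.
Proof.
by exists fset0; [split; [exact: legal0|exact: fsub0set]|exact: wsum0].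
Qed.

Lemma term_mex k : is_mex (legal_sums k) (a k).
Proof.
have [a0 aS] := a_seq; case: k => [|k].
  rewrite a0; split=> [[S [_]]|[|//] _]; last exact: legal_sums0.
  by rewrite segment0 fsubset0 => /eqP ->; rewrite wsum0.
have [_ ndec least] := aS k; split=> [/decomposableP //|m /= mk].
have [->|m_gt0] := posnP m; first exact: legal_sums0.
apply/decomposableP; apply: contrapT => m_ndec.
by have := least m m_gt0 m_ndec; rewrite leqNgt mk.
Qed.

Lemma term_incr k : a k < a k.+1.
Proof.
have [n_ak1 _] := term_mex k.+1; rewrite ltnNge leq_eqVlt; apply/negP.
move=> /orP[/eqP ak|/(term_mex k).2[S uS SE]]; apply: n_ak1.
  exists [fset k]; last by rewrite wsum1.
  by split; [exact: legal_fset1|rewrite fsub1set in_segment].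
by exists S => //; exact: legal_uptoW uS.
Qed.

Lemma term_gt k : k < a k.
Proof.
elim: k => [|k IHk]; last exact: leq_ltn_trans (term_incr k).
by have [->] := a_seq.
Qed.

Lemma wsum_surj : set_surj (legal b A) setT (wsum a).
Proof.
by move=> m _; have [S [lS _] SE] := (term_mex m).2 _ (term_gt m); exists S.
Qed.

Lemma wsum_eq0 (S : {fset nat}) : wsum a S = 0 -> S = fset0.
Proof.
move=> S0; apply/fsetP => i; rewrite in_fset0; apply/negP => iS.
by have := term_gt i; have := wsumD1 a i S; rewrite iS S0; lia.
Qed.

Lemma unique_decompositionP :
  (forall m, 0 < m -> exists! S : {fset nat}, legal_decomposition b A a m S) <->
  set_inj (legal b A) (wsum a).
Proof.
split=> [uniq S S' /set_mem lS /set_mem lS' SS'|inj m m_gt0].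
  have [S0|/uniq[T [_ T_uniq]]] := posnP (wsum a S).
    by rewrite (wsum_eq0 S0) (@wsum_eq0 S') // -SS'.
  by rewrite -(T_uniq S) // -(T_uniq S').
have [S lS SE] := wsum_surj (I : setT m); exists S; split=> // T [lT TE].
by apply: inj; rewrite ?inE // SE.
Qed.

Lemma wsum_inj_bins : (forall n, set_inj (legal_upto (start n)) (wsum a)) ->
  set_inj (legal b A) (wsum a).
Proof.
move=> inj S S' /set_mem lS /set_mem lS'.
have [j] := fsub_segment_ex (S `|` S'); rewrite fsubUset => /andP[sS sS'].
apply: (inj j); rewrite inE; split=> //;
  exact: fsub_segmentW (bin_start_ge j) _.
Qed.

Lemma wsum_tiling n : set_inj (legal b A) (wsum a) ->
  tiling (legal_sums (start n)) (wsum a @` legal_from (start n))%classic.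
Proof.
move=> inj; have sumU S T : legal_upto (start n) S -> legal_from (start n) T ->
    wsum a (S `|` T) = wsum a S + wsum a T.
  move=> [_ /fsub_segmentP sS] [_ /fdisjoint_segmentP dT].
  apply/wsumU/fdisjointP.
  by move=> i /sS i_n; apply/negP => /dT; lia.
have cutU S T : legal_upto (start n) S -> legal_from (start n) T ->
    (S `|` T) `\` segment (start n) = T.
  move=> [_ sS] [_ /fsetDidPl dT]; rewrite fsetDUl dT.
  by move: sS; rewrite -fsetD_eq0 => /eqP ->; rewrite fset0U.
split=> // [[x y] [x' y'] /set_mem[/= [S uS xE] [T fT yE]]|m _].
  move=> /set_mem[/= [S' uS' x'E] [T' fT' y'E]].
  rewrite -xE -yE -x'E -y'E -!sumU // => E.
  have {}E : S `|` T = S' `|` T'.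
    apply: inj => //; rewrite inE (legal_cut n).
      by exists S => //; exists T.
    by exists S' => //; exists T'.
  have TT' : T = T' by rewrite -(cutU S T) // E cutU.
  by move: (congr1 (wsum a) E); rewrite !sumU // TT' => /addIn ->.
have [S lS SE] := wsum_surj (I : setT m); move: lS; rewrite (legal_cut n).
move=> [S1 uS1 [T fT ST]]; exists (wsum a S1, wsum a T) => /=.
  by split; [exists S1|exists T].
by rewrite -sumU // ST.
Qed.

Section Bin.

Variables n N : nat.
Hypothesis sums_below : set_bij (legal_upto (start n)) `I_N (wsum a).

Local Notation p := (start n).

Lemma bin_first_term : a p = N.
Proof. exact: is_mex_inj (term_mex p) (set_bij_mex sums_below). Qed.

Lemma bin_unit_gt0 : 0 < N.
Proof. by rewrite -bin_first_term; exact: leq_ltn_trans (term_gt p). Qed.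

Section ScaledTerms.

Variables (w : nat -> nat) (j : nat).
Hypothesis j_le : j <= b n.
Hypothesis termE : forall i, i < j -> a (p + i) = N * w i.

Lemma wsum_scaled S T : legal_upto p S -> choices (A n) j T ->
  wsum a (S `|` shift p T) = wsum a S + N * wsum w T.
Proof.
move=> [_ /fsub_segmentP sS] [/fsub_segmentP sT _]; rewrite wsumU; last first.
  by apply/fdisjointP => i /sS; rewrite in_shift; lia.
by congr (_ + _); apply: wsum_shift => i /sT; exact: termE.
Qed.

Lemma legal_sums_scaled m :
  legal_sums (p + j) m <-> choice_sums (A n) w j (m %/ N).
Proof.
have [lt _ surj] := sums_below; rewrite /legal_sums legal_upto_bin //; split.
  move=> [_ [S uS [T cT <-]] <-]; exists T => //; rewrite wsum_scaled //.
  rewrite addnC mulnC divnMDl ?bin_unit_gt0 // divn_small ?addn0 //.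
  exact: lt uS.
move=> [T cT TE]; have [S uS SE] := surj _ (ltn_pmod m bin_unit_gt0).
exists (S `|` shift p T); first by exists S => //; exists T.
by rewrite wsum_scaled // SE TE addnC mulnC -divn_eq.
Qed.

Lemma wsum_bij_scaled Y : set_bij (choices (A n) j) `I_Y (wsum w) ->
  set_bij (legal_upto (p + j)) `I_(N * Y) (wsum a).
Proof.
move=> bij; rewrite legal_upto_bin //.
exact: set_bij_mixed_radix sums_below bij wsum_scaled.
Qed.

End ScaledTerms.

Lemma greedy_terms w j : greedy (A n) w j -> j <= (b n).+1 ->
  forall i, i < j -> a (p + i) = N * w i.
Proof.
move=> greedy_w jb; elim/ltn_ind => i IHi ij; have N_gt0 := bin_unit_gt0.
have sumsE m : legal_sums (p + i) m <-> choice_sums (A n) w i (m %/ N).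
  by apply: legal_sums_scaled => [|k ki]; [lia|apply: IHi; lia].
have [n_wi lt_wi] := greedy_w i ij; apply: is_mex_inj (term_mex _) _.
split=> [/sumsE|m /= mi]; first by rewrite mulKn.
by apply/sumsE/lt_wi => /=; rewrite ltn_divLR // mulnC.
Qed.

Lemma admissible_next_bin : admissible (b n) (A n) ->
  exists N', set_bij (legal_upto (start n.+1)) `I_N' (wsum a).
Proof.
move=> /admissible_greedy[w [Y [greedy_w bijY]]]; exists (N * Y).
by rewrite bin_startS; apply: wsum_bij_scaled bijY => //; exact: greedy_terms.
Qed.

Hypothesis wsum_inj : set_inj (legal b A) (wsum a).

Lemma choices_wsum_inj w j : j <= b n ->
  (forall i, i < j -> a (p + i) = N * w i) ->
  set_inj (choices (A n) j) (wsum w).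
Proof.
move=> jb termE T T' /set_mem[sT cT] /set_mem[sT' cT'] E.
have sumE U : U `<=` segment j -> wsum a (shift p U) = N * wsum w U.
  by move=> /fsub_segmentP sU; apply: wsum_shift => i /sU; exact: termE.
apply: (@shift_inj p); apply: wsum_inj; last by rewrite !sumE ?E.
  by rewrite inE; apply/legal_shift => //; exact: fsub_segmentW sT.
by rewrite inE; apply/legal_shift => //; exact: fsub_segmentW sT'.
Qed.

Lemma mex_le2_or_ge_bin t : is_mex [set` A n] t -> t <= 2 \/ b n <= t.
Proof.
move=> mex_t; have [t2|t3] := leqP t 2; [by left|right].
rewrite leqNgt; apply/negP => tb.
case: t => [//|u] in mex_t t3 tb *.
have two_in_A : 2 \in A n by exact: mex_t.2.
have termE i : i < u.+3 -> a (p + i) = N * run_weight u i.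
  exact: greedy_terms (greedy_run_weight mex_t) _ i.
have p_bin i : i < b n -> in_bin b n (p + i) by rewrite /in_bin bin_startS; lia.
have legal_pair i k : i < b n -> legal b A [fset p + i; p + k].
  by move=> ib; apply: legal_fset2 => m /(in_bin_inj (p_bin i ib)) <-.
(* [2 ^ u + (2 ^ u.+1 - 1) = 1 + (3 * 2 ^ u - 2)] *)
have E : [fset p + u; p + u.+1] = [fset p + 0; p + u.+2].
  apply: wsum_inj; rewrite ?inE; [by apply: legal_pair; lia..|].
  rewrite !wsumU1 ?wsum1 ?inE ?eqn_add2l; [|lia..].
  rewrite !termE -?mulnDr /run_weight; [|lia..].
  rewrite leqnn ltnn eqxx !ifF ?expnS; [|lia..].
  by rewrite leq0n expn0; congr muln; have := expn_gt0 2 u; lia.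
by have := fset1U1 (p + 0) [fset p + u.+2]; rewrite -E !inE !eqn_add2l; lia.
Qed.

Section LeastAbove1.

Variable s : nat.
Hypothesis s_gt2 : 2 < s.
Hypothesis A_s : least_above1 (A n) s.

Lemma arithmetic_terms i : i < s.+2 -> i <= b n -> a (p + i) = N * i.+1.
Proof.
move=> is2 ib; apply: (@greedy_terms succn (minn s.+2 (b n).+1)); last lia.
  by apply: greedy_succn A_s _; rewrite ?geq_minl.
by rewrite geq_minr.
Qed.

Lemma least_above1_bin_le : b n <= s.+1.
Proof.
rewrite leqNgt; apply/negP => sb.
apply: (@least_above1_exchange _ _ s.+2 A_s); [lia..|].
by apply: choices_wsum_inj => // i is2; apply: arithmetic_terms; lia.
Qed.

Lemma arithmetic_next_bin_term : a (start n.+1) = N * (b n).+1.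
Proof.
rewrite bin_startS; apply: arithmetic_terms => //.
by have := least_above1_bin_le; lia.
Qed.

Lemma legal_sums_arithmetic m :
  legal_sums (start n.+1) m <-> choice_sums (A n) succn (b n) (m %/ N).
Proof.
rewrite bin_startS; apply: legal_sums_scaled => // i ib.
by apply: arithmetic_terms; have := least_above1_bin_le; lia.
Qed.

Lemma least_above1_bin_lt : b n < s.
Proof.
rewrite ltnNge; apply/negP => sb; have bs := least_above1_bin_le.
have N_gt0 := bin_unit_gt0; have sumsE := legal_sums_arithmetic.
pose V := wsum succn (segment s); set X := N * (b n).+1.
have X_gt0 : 0 < X by rewrite muln_gt0 N_gt0.
have below : (`I_X `<=` legal_sums (start n.+1))%classic.
  by rewrite /X -arithmetic_next_bin_term; exact: (term_mex _).2.
have X_from : (wsum a @` legal_from (start n.+1))%classic X.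
  exists [fset start n.+1]; last by rewrite wsum1 arithmetic_next_bin_term.
  by split; [exact: legal_fset1|rewrite fdisjoint1X in_segment ltnn].
have V_sum : legal_sums (start n.+1) (N * V).
  by apply/sumsE; rewrite mulKn //; exact: least_above1_segment A_s sb.
have XV : X <= N * V.
  by rewrite leq_mul2l; have := wsum_segment_succn s; rewrite -/V; nia.
have gap x : legal_sums (start n.+1) x -> x < N * V -> x < X.
  move=> /sumsE/(least_above1_sums_gap A_s).
  rewrite ltn_divLR // mulnC => le_bn /le_bn.
  by rewrite -ltnS ltn_divLR // mulnC.
have NX : N < X by rewrite ltn_Pmulr // ltnS b_gt0.
have tile := wsum_tiling n.+1 wsum_inj.
have dvdV := tiling_gap_dvd tile X_gt0 below V_sum XV gap.
have := tiling_gap_interval tile X_gt0 below X_from V_sum XV gap NX.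
move=> /sumsE; rewrite -mulnSr mulKn //.
apply: least_above1_no_interval A_s s_gt2 _ _; first by rewrite sb.
by rewrite -(@dvdn_pmul2l N).
Qed.

End LeastAbove1.

Lemma admissible_of_inj : A n `<=` segment (b n).+1 -> admissible (b n) (A n).
Proof.
move=> A_le.
case: (admissible_or_obstructed (zero_in_A n) (one_in_A n) A_le) => //.
  by move=> [t t_mid /mex_le2_or_ge_bin]; lia.
move=> [s s_gt2 A_s]; have := fsub_segmentP _ _ A_le s A_s.1.
by have := least_above1_bin_lt s_gt2 A_s; lia.
Qed.

End Bin.

Lemma admissible_bins_bij n : (forall i, i < n -> admissible (b i) (A i)) ->
  exists N, set_bij (legal_upto (start n)) `I_N (wsum a).
Proof.
elim: n => [_|n IHn adm]; last first.
  have [|N bijN] := IHn; first by move=> i /ltnW; exact: adm.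
  exact: admissible_next_bin bijN (adm n _).
have upto0 S : legal_upto (start 0) S -> S = fset0.
  by case=> _; rewrite /bin_start big_ord0 segment0 fsubset0 => /eqP.
exists 1; split=> [S /upto0 ->|S S' /set_mem/upto0 -> /set_mem/upto0 ->|] //.
  by rewrite /= wsum0.
by move=> [|//] _; exact: legal_sums0.
Qed.

End BinSequence.

Theorem theorem1p1 (b : nat -> nat) (A : nat -> {fset nat}) (a : nat -> nat)
    (b_gt0 : forall n, 0 < b n)
    (A_ge : forall n, [fset 0; 1] `<=` A n)
    (A_le : forall n, A n `<=` [fset k in iota 0 (b n).+1])
    (a_seq : is_bin_sequence b A a) :
  (forall m, 0 < m -> exists! S : {fset nat}, legal_decomposition b A a m S) <->
  (forall n, [\/ A n = [fset 0; 1],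
                 A n = [fset k in iota 0 (b n)]
               | A n = [fset k in iota 0 (b n).+1]]).
Proof.
have zero_in_A n : 0 \in A n by apply: (fsubsetP (A_ge n)); rewrite !inE.
have one_in_A n : 1 \in A n by apply: (fsubsetP (A_ge n)); rewrite !inE.
rewrite (unique_decompositionP zero_in_A one_in_A a_seq).
change (set_inj (legal b A) (wsum a) <-> forall n, admissible (b n) (A n)).
split=> [inj n|adm].
  elim/ltn_ind: n => n IHn.
  have [N bijN] := admissible_bins_bij zero_in_A one_in_A a_seq IHn.
  exact: (admissible_of_inj b_gt0 zero_in_A one_in_A a_seq bijN inj (A_le n)).
apply: (wsum_inj_bins b_gt0) => n.
by have [|N []] := @admissible_bins_bij b A a zero_in_A one_in_A a_seq n.
Qed.
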